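(* Let $G\subset SL(n,\mathbb{C})$ be a finite abelian subgroup and let $\widetilde{Y_{H_1}},\widetilde{Y_{H_2}},\dots,\widetilde{Y_{H_k}}=\widetilde{Y_G}$ be a sequence of iterated Fujiki-Oka resolutions for the $n$-dimensional Gorenstein abelian quotient singularity $\mathbb{C}^n/G$. If the ages of all the coefficients in the remainder polynomials associated with every $\widetilde{Y_{H_i}}$ $(i=1,\dots,k)$ are $1$, then the corresponding iterated Fujiki-Oka resolution $\widetilde{Y_G}$ of $\mathbb{C}^n/G$ is crepant.
   Context: Notation. $G$ is assumed to consist of diagonal matrices (after conjugation). $\frac1r(a_1,\dots,a_n)$, $0\le a_i<r$, denotes the matrix $\mathrm{diag}(e^{2\pi\sqrt{-1}a_1/r},\dots,e^{2\pi\sqrt{-1}a_n/r})$ as well as the vector $(a_1/r,\dots,a_n/r)$. For a finite diagonal group $H$ put $N_H=\mathbb{Z}^n+\sum_{\frac1r(a_1,\dots,a_n)\in H}\mathbb{Z}\,\frac1r(a_1,\dots,a_n)$. With $\sigma=\mathbb{R}^n_{\ge0}$, $\mathbb{C}^n/H$ is the toric variety $X(N_H,\sigma)$. For $v\in\mathbb{R}^n$, $\mathrm{age}(v)=\sum_i v_i$. Crepancy. For a smooth (with respect to $N_G$) fan $\Sigma$ subdividing $\sigma$, the divisor of a ray $\tau\in\Sigma$ has discrepancy $\mathrm{age}(A_\tau)-1$, $A_\tau$ being the primitive generator of $\tau$ in $N_G$; the resolution $X(N_G,\Sigma)\to X(N_G,\sigma)$ is crepant if all discrepancies vanish, i.e.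 every $A_\tau$ has age $1$. Proper fractions and remainder polynomial. An $n$-dimensional proper fraction is a symbol $\frac{\mathbf{a}}{r}=\frac{(a_1,\dots,a_n)}{r}$ with $r\ge1$ and integers $0\le a_i\le r-1$; its age is $\frac1r\sum_i a_i$. For $2\le i\le n$, $$R_i\left(\tfrac{(a_1,\dots,a_n)}{r}\right)=\frac{(\overline{a_1}^{a_i},\dots,\overline{a_{i-1}}^{a_i},\overline{-r}^{a_i},\overline{a_{i+1}}^{a_i},\dots,\overline{a_n}^{a_i})}{a_i}\ \text{ if } a_i\ne0,$$ $R_i=\infty$ if $a_i=0$, and $R_i(\infty)=\infty$, where $\overline{x}^{m}\in\{0,\dots,m-1\}$ is the residue of $x$ modulo $m$. The remainder polynomial of $\frac{\mathbf{a}}{r}$ with $a_1=1$ is the formal sum in noncommuting variables $$\mathcal{R}_*\left(\tfrac{\mathbf{a}}{r}\right)=\tfrac{\mathbf{a}}{r}+\sum_{l\ge1}\sum_{(i_1,\dots,i_l)\in\{2,\dots,n\}^l}(R_{i_l}\cdots R_{i_1})\left(\tfrac{\mathbf{a}}{r}\right)x_{i_1}\cdots x_{i_l},$$ excluding terms with coefficient $\infty$ or $\frac{(0,\dots,0)}{1}$. Fujiki-Oka subdivision. Fix a lattice $M\subset\mathbb{R}^n$ of rank $n$. An $n$-dimensional simplicial cone $\tau$ with primitive generators $P_1,\dots,P_n\in M$ is semi-unimodular over $P_1$ (after reordering the generators, any of them can play this role) if $P_2,\dots,P_n$ is part of a $\mathbb{Z}$-basis of $M$. Let $s=[M:\bigoplus\mathbb{Z}P_i]$.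 If $s>1$ there are unique integers $0\le b_i\le s-1$ such that the Oka center $C=\frac1s(P_1+\sum_{i\ge2}b_iP_i)$ lies in $M$ and $C,P_2,\dots,P_n$ is a $\mathbb{Z}$-basis of $M$; $\frac{(1,b_2,\dots,b_n)}{s}$ is the proper fraction of $\tau$ over $P_1$. Star-subdividing $\tau$ at $C$ gives the smooth cone on $C,P_2,\dots,P_n$ and, for each $i\ge 2$ with $b_i\ne0$, the cone $\tau_i$ obtained by replacing $P_i$ by $C$; $\tau_i$ is again semi-unimodular over $P_1$, of index $b_i$, with proper fraction $R_i\left(\frac{(1,b_2,\dots,b_n)}{s}\right)$ if $b_i>1$. Repeating (always over $P_1$) until all maximal cones are smooth gives the Fujiki-Oka subdivision of $\tau$. If $s=1$, $\tau$ is left unchanged. Iterated Fujiki-Oka resolutions. A sequence of iterated Fujiki-Oka resolutions for $\mathbb{C}^n/G$ consists of a chain of subgroups $H_1\subset H_2\subset\dots\subset H_k=G$, with $H_1$ cyclic and each $H_{i}$ a direct factor of $H_{i+1}$ (a component of a decomposition of $H_{i+1}$ into cyclic subgroups), together with fans $\Sigma_1,\dots,\Sigma_k$ as follows. Put $\Sigma_0=\{\text{faces of }\sigma\}$. For each $i=1,\dots,k$, all maximal cones of $\Sigma_{i-1}$ are semi-unimodular with respect to the lattice $N_{H_i}$ over some generator, and $\Sigma_i$ is the fan obtained by replacing each maximal cone of $\Sigma_{i-1}$ by its Fujiki-Oka subdivision with respect to $N_{H_i}$ over a chosen such generator. Then $\widetilde{Y_{H_i}}=X(N_{H_i},\Sigma_i)$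 is a resolution of $\mathbb{C}^n/H_i$. The remainder polynomials associated with $\widetilde{Y_{H_i}}$ are the remainder polynomials of the proper fractions (with respect to $N_{H_i}$, over the chosen generators) of the non-smooth maximal cones of $\Sigma_{i-1}$. The case $k=1$ is the ordinary Fujiki-Oka resolution. *)

(* Defs.v *)
From HB Require Import structures.
From mathcomp Require Import all_boot all_order all_algebra all_fingroup.
From mathcomp Require Import all_solvable all_character.
From mathcomp Require Import complex.
From mathcomp Require Import boolp classical_sets cardinality reals trigo.

Set Implicit Arguments.
Unset Strict Implicit.
Unset Printing Implicit Defensive.

Import Order.TTheory GRing.Theory Num.Theory.

Local Open Scope classical_set_scope.
Local Open Scope ring_scope.

(* The dimension is n.+1 throughout: the paper's index 1 is ord0 and its      *)
(* indices 2, ..., n are lift ord0 i for i : 'I_n.                            *)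

Section ProperFractions.
Variable n : nat.

Record proper_frac := ProperFrac {
  num : {ffun 'I_n.+1 -> nat};
  den : nat;
  num_lt_den : forall i, (num i < den)%N }.

Definition frac_age (f : proper_frac) : rat :=
  (\sum_i num f i)%:R / (den f)%:R.

Definition residue (m : nat) (x : int) : nat := `|(x %% m%:Z)%Z|%N.

Lemma residue_lt (m : nat) (x : int) : (residue m.+1 x < m.+1)%N.
Proof. by rewrite /residue -ltz_nat gez0_abs ?modz_ge0 ?ltz_pmod. Qed.

Lemma residue_frac_subproof (m : nat) (x : 'I_n.+1 -> int) (j : 'I_n.+1) :
  ([ffun j => residue m.+1 (x j)] j < m.+1)%N.
Proof. by rewrite ffunE residue_lt. Qed.

Definition residue_frac (m : nat) (x : 'I_n.+1 -> int) : proper_frac :=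
  ProperFrac (residue_frac_subproof m x).

(* The remainder map R_i; None stands for the symbol infinity.                *)
Definition remainder_map (i : 'I_n) (f : proper_frac) : option proper_frac :=
  match num f (lift ord0 i) with
  | 0%N => None
  | m.+1 => Some (residue_frac m (fun j =>
      if j == lift ord0 i then - (den f)%:Z else (num f j)%:Z))
  end.

Definition trivial_frac (f : proper_frac) : bool :=
  (den f == 1%N) && [forall i, num f i == 0%N].

(* A formal sum in the noncommuting variables x_2, ..., x_n is a map from     *)
(* words to coefficients; None means that the term does not occur.            *)
Definition remainder_poly (f : proper_frac) (w : seq 'I_n) :
    option proper_frac :=
  if foldl (fun c i => obind (remainder_map i) c) (Some f) w is Some g then
    if trivial_frac g then None else Some g
  else None.

Definition remainder_coef (f g : proper_frac) : Prop :=
  exists w, remainder_poly f w = Some g.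

End ProperFractions.

Section ToricGeometry.
Variables (R : realType) (n : nat).
Local Notation V := 'rV[R]_n.+1.

Definition age (v : V) : R := \sum_i v 0 i.

Definition frac_vec (f : proper_frac n) : V :=
  \row_i ((num f i)%:R / (den f)%:R).

(* Lattices and families of vectors: a family of m vectors is given by the    *)
(* rows of a matrix with m rows.                                              *)

Definition zrows m (A : 'M[R]_(m, n.+1)) : set V :=
  [set v | exists z : 'rV[int]_m, v = map_mx intr z *m A].

Definition zspan (S : set V) : set V :=
  [set v | exists m (A : 'M[R]_(m, n.+1)), (forall i, S (row i A)) /\ zrows A v].

Definition zbasis (M : set V) (B : 'M[R]_n.+1) : Prop :=
  row_free B /\ M = zrows B.

Definition primitive (M : set V) (v : V) : Prop :=
  [/\ M v, v != 0 & forall (w : V) (m : nat), M w -> v = w *+ m -> m = 1%N].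

Definition has_index (M L : set V) (s : nat) : Prop :=
  ((fun v => [set v + w | w in L]) @` M #= `I_s)%card.

Definition cone m (A : 'M[R]_(m, n.+1)) : set V :=
  [set v | exists c : 'rV[R]_m, (forall i, 0 <= c 0 i) /\ v = c *m A].

Definition orthant : set V := [set v | forall i, 0 <= v 0 i].

Definition is_face (F tau : set V) : Prop :=
  exists u : 'cV[R]_n.+1,
    (forall x, tau x -> 0 <= (x *m u) 0 0) /\
    F = [set x | tau x /\ (x *m u) 0 0 = 0].

Definition rational_polyhedral (M tau : set V) : Prop :=
  exists m (A : 'M[R]_(m, n.+1)), (forall i, M (row i A)) /\ tau = cone A.

Definition strongly_convex (tau : set V) : Prop :=
  forall x, tau x -> tau (- x) -> x = 0.

Record is_fan (M : set V) (Sigma : set (set V)) : Prop := IsFan {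
  fan_finite : finite_set Sigma;
  fan_cone : forall tau, Sigma tau ->
    rational_polyhedral M tau /\ strongly_convex tau;
  fan_face : forall tau F, Sigma tau -> is_face F tau -> Sigma F;
  fan_meet : forall tau1 tau2, Sigma tau1 -> Sigma tau2 ->
    is_face (tau1 `&` tau2) tau1 /\ is_face (tau1 `&` tau2) tau2 }.

Definition maximal_cone (Sigma : set (set V)) (tau : set V) : Prop :=
  Sigma tau /\ forall tau', Sigma tau' -> tau `<=` tau' -> tau' = tau.

Definition smooth_cone (M tau : set V) : Prop :=
  exists B, zbasis M B /\
    exists m (f : 'I_m -> 'I_n.+1), injective f /\ tau = cone (rowsub f B).

Definition toric_resolution (M : set V) (Sigma : set (set V)) : Prop :=
  [/\ is_fan M Sigma,
      forall tau, Sigma tau -> smooth_cone M tau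
    & \bigcup_(tau in Sigma) tau = orthant].

(* Rays are the cones generated by a single nonzero vector; v is A_tau.       *)
Definition ray_generator (M : set V) (Sigma : set (set V)) (v : V) : Prop :=
  primitive M v /\ Sigma (cone v).

Definition discrepancy (v : V) : R := age v - 1.

Definition crepant_resolution (M : set V) (Sigma : set (set V)) : Prop :=
  toric_resolution M Sigma /\
  forall v, ray_generator M Sigma v -> discrepancy v = 0.

(* Fujiki-Oka subdivisions.  A simplicial cone is given by the matrix P of    *)
(* its primitive generators, ordered so that row ord0 is the generator P_1    *)
(* over which one works.                                                      *)

Definition semi_unimodular (M : set V) (P : 'M[R]_n.+1) : Prop :=
  [/\ row_free P, forall i, primitive M (row i P)
    & exists B, zbasis M B /\ row' ord0 B = row' ord0 P].

Definition replace (P : 'M[R]_n.+1) (i : 'I_n.+1) (C : V) : 'M[R]_n.+1 :=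
  \matrix_j (if j == i then C else row j P).

Definition oka_center (P : 'M[R]_n.+1) (f : proper_frac n) : V :=
  frac_vec f *m P.

(* f is the proper fraction of cone P over P_1; it exists only if the index s *)
(* is > 1.                                                                    *)
Definition cone_frac (M : set V) (P : 'M[R]_n.+1) (f : proper_frac n) : Prop :=
  [/\ has_index M (zrows P) (den f), (1 < den f)%N, num f ord0 = 1%N,
      M (oka_center P f)
    & zbasis M (replace P ord0 (oka_center P f))].

(* fujiki_oka_cone M P Q: Q generates a maximal cone of the Fujiki-Oka        *)
(* subdivision of cone P over P_1.                                            *)
Inductive fujiki_oka_cone (M : set V) :
    'M[R]_n.+1 -> 'M[R]_n.+1 -> Prop :=
| FO_unchanged P : has_index M (zrows P) 1 -> fujiki_oka_cone M P P
| FO_smooth P f : cone_frac M P f ->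
    fujiki_oka_cone M P (replace P ord0 (oka_center P f))
| FO_step P f (i : 'I_n) Q : cone_frac M P f ->
    num f (lift ord0 i) != 0%N ->
    fujiki_oka_cone M (replace P (lift ord0 i) (oka_center P f)) Q ->
    fujiki_oka_cone M P Q.

(* P tau consists of the ordered generators chosen for tau.                   *)
Definition fujiki_oka_fan (M : set V) (P : set V -> 'M[R]_n.+1)
    (Sigma : set (set V)) : set (set V) :=
  [set F | exists tau Q, [/\ maximal_cone Sigma tau,
     fujiki_oka_cone M (P tau) Q & is_face F (cone Q)]].

(* The rows of P tau are the primitive generators of tau, so tau is smooth    *)
(* exactly when they form a basis of M.                                       *)
Definition fan_frac (M : set V) (P : set V -> 'M[R]_n.+1)
    (Sigma : set (set V)) (f : proper_frac n) : Prop :=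
  exists tau, [/\ maximal_cone Sigma tau, ~ zbasis M (P tau)
    & cone_frac M (P tau) f].

End ToricGeometry.

Section QuotientSingularities.
Variables (R : realType) (n : nat) (gT : finGroupType) (G : {group gT}).
Variable rG : mx_representation R[i] G n.+1.
Local Notation V := 'rV[R]_n.+1.

Definition cexp_turn (t : R) : R[i] :=
  (cos (2 * pi * t) +i* sin (2 * pi * t))%C.

Definition frac_mx (f : proper_frac n) : 'M[R[i]]_n.+1 :=
  diag_mx (map_mx cexp_turn (frac_vec R f)).

(* N_H, where H is identified with its image under rG.                        *)
Definition group_lattice (H : {group gT}) : set V :=
  [set v | exists (z : 'rV[int]_n.+1) (u : V),
     zspan [set w | exists f h,
       [/\ h \in H, rG h = frac_mx f & w = frac_vec R f]] u /\
     v = map_mx intr z + u].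

(* Stage i, for 1 <= i <= k, consists of the subgroup H i, the fan Sigma i    *)
(* and the ordered generators P i tau chosen for each maximal cone tau of     *)
(* Sigma i.-1; the values of H, Sigma and P elsewhere are irrelevant.         *)
Record iterated_fujiki_oka (k : nat) (H : nat -> {group gT})
    (Sigma : nat -> set (set V)) (P : nat -> set V -> 'M[R]_n.+1) : Prop :=
  IteratedFujikiOka {
    ifo_length : (0 < k)%N;
    ifo_cyclic : cyclic (H 1%N);
    ifo_last : H k = G;
    ifo_direct_factor : forall i, (1 <= i < k)%N ->
      exists K : {group gT}, (H i \x K = H i.+1)%g;
    ifo_start : Sigma 0%N = [set F | is_face F (@orthant R n)];
    ifo_generators : forall i, (1 <= i <= k)%N ->
      forall tau, maximal_cone (Sigma i.-1) tau ->
      tau = cone (P i tau) /\ semi_unimodular (group_lattice (H i)) (P i tau);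
    ifo_subdivision : forall i, (1 <= i <= k)%N ->
      Sigma i = fujiki_oka_fan (group_lattice (H i)) (P i) (Sigma i.-1);
    ifo_fan : forall i, (1 <= i <= k)%N ->
      is_fan (group_lattice (H i)) (Sigma i) }.

End QuotientSingularities.

(* Main.v *)
Require Import Defs.
From HB Require Import structures.
From mathcomp Require Import all_boot all_order all_algebra all_fingroup.
From mathcomp Require Import all_solvable all_character.
From mathcomp Require Import complex.
From mathcomp Require Import boolp classical_sets cardinality reals trigo.
From mathcomp Require Import zify ring lra.

Set Implicit Arguments.
Unset Strict Implicit.
Unset Printing Implicit Defensive.

Import Order.TTheory GRing.Theory Num.Theory.

Local Open Scope ring_scope.

(* The age is linear, so the Oka center of a cone whose generators have age 1
   has the age of the proper fraction of that cone.  Along the algorithm this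
   fraction changes by R_i, hence every fraction met is a coefficient of the
   remainder polynomial and every new ray generator has age 1.  Passing from
   N_(H_i) to the larger lattice N_(H_(i+1)) could make these generators
   divisible; but G lies in SL, so all ages in N_G are integers, and a vector
   of age 1 on the ray of a primitive vector must then be that vector. *)

(** * Integral row combinations and lattice bases *)

Section RowCombinations.
Variables (R : realType) (n : nat).
Local Notation V := 'rV[R]_n.+1.
Implicit Types (M : set V) (B P : 'M[R]_n.+1) (v C : V).

Lemma zrowsP m (A : 'M[R]_(m, n.+1)) v :
  zrows A v <-> exists c : 'I_m -> int, v = \sum_i (c i)%:~R *: row i A.
Proof.
split=> [[z ->]|[c ->]].
  by exists (z 0); rewrite mulmx_sum_row; apply: eq_bigr => i _; rewrite mxE.
exists (\row_i c i); rewrite mulmx_sum_row.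
by apply: eq_bigr => i _; rewrite !mxE.
Qed.

Lemma zrowsD m (A : 'M[R]_(m, n.+1)) v w :
  zrows A v -> zrows A w -> zrows A (v + w).
Proof. by move=> [y ->] [z ->]; exists (y + z); rewrite map_mxD mulmxDl. Qed.

Lemma zrowsZ m (A : 'M[R]_(m, n.+1)) (z : int) v :
  zrows A v -> zrows A (z%:~R *: v).
Proof.
move=> [y ->]; exists (z *: y); rewrite scalemxAl; congr (_ *m _).
by apply/matrixP => i j; rewrite !mxE rmorphM.
Qed.

Lemma zrows0 m (A : 'M[R]_(m, n.+1)) : zrows A 0.
Proof. by exists 0; rewrite map_mx0 mul0mx. Qed.

Lemma zrowsB m (A : 'M[R]_(m, n.+1)) v w :
  zrows A v -> zrows A w -> zrows A (v - w).
Proof.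
by move=> hv /(zrowsZ (-1)); rewrite mulrN1z scaleN1r => /(zrowsD hv).
Qed.

Lemma zrows_sum m (A : 'M[R]_(m, n.+1)) (I : finType) (F : I -> V) :
  (forall i, zrows A (F i)) -> zrows A (\sum_i F i).
Proof.
move=> hF; elim/big_ind: _ => //; [exact: zrows0 | exact: zrowsD].
Qed.

Lemma zrows_row m (A : 'M[R]_(m, n.+1)) i : zrows A (row i A).
Proof.
by exists (delta_mx 0 i); rewrite rowE; congr (_ *m _); rewrite map_delta_mx.
Qed.

Lemma zrows_sub m m' (A : 'M[R]_(m, n.+1)) (A' : 'M[R]_(m', n.+1)) v :
  (forall i, zrows A' (row i A)) -> zrows A v -> zrows A' v.
Proof.
move=> hA /zrowsP[c ->]; apply: zrows_sum => i; exact: zrowsZ.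
Qed.

Lemma sum_rows m (A : 'M[R]_(m, n.+1)) (a : 'I_m -> R) :
  \sum_i a i *: row i A = (\row_i a i) *m A.
Proof. by rewrite mulmx_sum_row; apply: eq_bigr => i _; rewrite mxE. Qed.

Lemma row_free_coord B (a b : 'I_n.+1 -> R) : row_free B ->
  \sum_i a i *: row i B = \sum_i b i *: row i B -> forall i, a i = b i.
Proof.
by move=> fB; rewrite !sum_rows => /(row_free_inj fB)/rowP e i;
  move: (e i); rewrite !mxE.
Qed.

Lemma zbasis_coord M B (a : 'I_n.+1 -> R) : zbasis M B ->
  M (\sum_i a i *: row i B) -> forall i, exists z : int, a i = z%:~R.
Proof.
by move=> [fB ->] /zrowsP[c /(row_free_coord fB) ac] i; exists (c i).
Qed.

Lemma zbasis_row M B i : zbasis M B -> M (row i B).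
Proof. by move=> [_ ->]; exact: zrows_row. Qed.

Lemma zrows_submx m (A : 'M[R]_(m, n.+1)) v : zrows A v -> (v <= A)%MS.
Proof. by move=> [z ->]; exact: submxMl. Qed.

(** The rows of [B] lie in the row space of [B'], which gives [B'] full rank; the two lattices
    contain each other row by row. *)
Lemma zbasis_change M B B' : zbasis M B ->
  (forall i, M (row i B')) -> (forall i, zrows B' (row i B)) -> zbasis M B'.
Proof.
move=> [fB eM] MB' BB'; split.
  rewrite -row_leq_rank; move: fB; rewrite -row_leq_rank => /leq_trans; apply.
  by apply/mxrankS/row_subP => i; exact: zrows_submx.
rewrite eM; apply/seteqP; split => v; first exact: zrows_sub.
by apply: zrows_sub => i; rewrite -eM.
Qed.

Lemma row_replace P i C j : row j (replace P i C) =
  if j == i then C else row j P.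
Proof. by rewrite rowK. Qed.

Lemma replace_neq P i C j : j != i -> row j (replace P i C) = row j P.
Proof. by rewrite row_replace => /negbTE->. Qed.

Lemma sum_replace P i C (a : 'I_n.+1 -> R) :
  \sum_j a j *: row j (replace P i C) =
  a i *: C + \sum_(j | j != i) a j *: row j P.
Proof.
rewrite (bigD1 i) //= row_replace eqxx; congr (_ + _).
by apply: eq_bigr => j /replace_neq ->.
Qed.

Lemma sum_replace0 P C (a : 'I_n.+1 -> R) :
  \sum_j a j *: row j (replace P ord0 C) =
  a ord0 *: C + \sum_(j < n) a (lift ord0 j) *: row (lift ord0 j) P.
Proof.
rewrite big_ord_recl row_replace eqxx; congr (_ + _).
by apply: eq_bigr => j _; rewrite replace_neq.
Qed.

End RowCombinations.

(** * The index of the lattice spanned by the generators of a cone *)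

Section Index.
Variables (R : realType) (n : nat).
Local Notation V := 'rV[R]_n.+1.
Implicit Types (M : set V) (B P : 'M[R]_n.+1) (v C : V).

(* [C] need not be the Oka center: the coefficients [z] are only determined
   modulo [s] up to replacing [C] by an integral translate. *)
Definition transverse_basis M P C (s : nat) (z : 'I_n -> int) : Prop :=
  [/\ zbasis M (replace P ord0 C), (0 < s)%N &
      row ord0 P = s%:R *: C + \sum_j (z j)%:~R *: row (lift ord0 j) P].

Lemma transverse_basis_coord M P C s z v : transverse_basis M P C s z -> M v ->
  exists (x0 : int) (x : 'I_n -> int),
    v = x0%:~R *: C + \sum_j (x j)%:~R *: row (lift ord0 j) P.
Proof.
move=> [[_ ->] _ _] /zrowsP[c ->].
exists (c ord0), (fun j => c (lift ord0 j)).
by rewrite (sum_replace0 P C (fun j => (c j)%:~R)).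
Qed.

Lemma transverse_basis_row M P C s z i :
  transverse_basis M P C s z -> M (row i P).
Proof.
move=> [bM s0 e]; have Mj j : M (row (lift ord0 j) P).
  by have := zbasis_row (lift ord0 j) bM; rewrite replace_neq.
have MC : M C by have := zbasis_row ord0 bM; rewrite row_replace eqxx.
case: (unliftP ord0 i) => [j|] -> //.
rewrite e; move: MC Mj; case: bM => _ -> MC Mj.
apply: zrowsD; first by rewrite -[s%:R]/((s%:Z)%:~R); exact: zrowsZ.
by apply: zrows_sum => j; exact: zrowsZ.
Qed.

Lemma zrows_coset P v w :
  [set (v + u)%R | u in zrows P]%classic =
  [set (w + u)%R | u in zrows P]%classic <-> zrows P (v - w).
Proof.
split=> [e|h].
  have : [set (w + u)%R | u in zrows P]%classic v.
    by rewrite -e; exists 0; [exact: zrows0 | rewrite addr0].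
  by move=> [u Pu <-]; rewrite addrC addKr.
apply/seteqP; split => _ [u Pu <-].
  by exists (v - w + u); [exact: zrowsD | rewrite addrA subrKC].
exists (u - (v - w)); first exact: zrowsB.
by rewrite opprB addrCA subrKC addrC.
Qed.

(** Modulo the rows of [P] the lattice is cyclic, generated by [C], and [s] is the order of [C]: the
    cosets of [k C] with [k < s] are distinct and exhaust the quotient. *)
Lemma transverse_basis_index M P C s z :
  transverse_basis M P C s z -> has_index M (zrows P) s.
Proof.
move=> tb; have [bM s0 e] := tb; rewrite /has_index.
pose K v := [set (v + u)%R | u in zrows P]%classic.
suff -> : (K @` M = (fun k : nat => K (k%:R *: C)) @` `I_s)%classic.
  apply: inj_card_eq => k k' /set_mem /= ks /set_mem /= ks'.
  move=> /zrows_coset /zrowsP[y]; rewrite -scalerBl big_ord_recl e => ey.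
  (* Both sides are expanded in the basis; the coordinate along [C] reads [k - k' = q * s], and
     [k, k' < s] forces [q = 0]. *)
  have : \sum_j (if j == ord0 then k%:R - k'%:R else 0) *: row j (replace P
    ord0 C)
     = \sum_j (if unlift ord0 j is Some i then (y ord0 * z i +
       y (lift ord0 i))%:~R
        else (y ord0 * s%:Z)%:~R) *: row j (replace P ord0 C).
    rewrite !sum_replace0 eqxx unlift_none [X in _ + X]big1 ?addr0; last first.
      by move=> j _; rewrite scale0r.
    rewrite ey scalerDr scalerA -addrA; congr (_ + _); first by rewrite intrM.
    rewrite scaler_sumr -big_split /=; apply: eq_bigr => j _.
    by rewrite liftK scalerA -scalerDl intrD intrM.
  move/row_free_coord => /(_ bM.1 ord0); rewrite eqxx unlift_none.
  rewrite -[k%:R]/((k%:Z)%:~R) -[k'%:R]/((k'%:Z)%:~R) -intrB => /intr_inj.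
  move: (y ord0) => q; clear -ks ks' => eq.
  have [q0|[q1|q1]] : q = 0 \/ q <= -1 \/ 1 <= q by lia.
  - by move: eq; rewrite q0; lia.
  - nia.
  - nia.
apply/seteqP; split => _ [v Mv <-]; last first.
  exists (v%:R *: C) => //.
  have MC : M C by have := zbasis_row ord0 bM; rewrite row_replace eqxx.
  move: MC; case: bM => _ -> MC.
  by rewrite -[v%:R]/((v%:Z)%:~R); exact: zrowsZ.
have [x0 [x ->]] := transverse_basis_coord tb Mv.
(* Since [s C] is an integral combination of the rows of [P], only the remainder of [x0] modulo [s]
   affects the coset. *)
exists `|(x0 %% s%:Z)%Z|%N.
  by rewrite /= -ltz_nat gez0_abs ?modz_ge0 ?ltz_pmod //; lia.
apply/esym/zrows_coset.
have -> : `|(x0 %% s%:Z)%Z|%N%:R = ((x0 %% s%:Z)%Z)%:~R :> R.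
  by rewrite -[LHS]/((_ %:Z)%:~R) gez0_abs ?modz_ge0 //; lia.
rewrite addrAC -scalerBl -intrB.
have -> : x0 - (x0 %% s)%Z = (x0 %/ s)%Z * s.
  by rewrite {1}(divz_eq x0 s%:Z) addrK.
rewrite intrM -scalerA.
have -> : s%:~R *: C = row ord0 P - \sum_j (z j)%:~R *: row (lift ord0 j) P.
  by rewrite e addrK.
apply: zrowsD.
  apply/zrowsZ/zrowsB; first exact: zrows_row.
  by apply: zrows_sum => j; apply/zrowsZ/zrows_row.
by apply: zrows_sum => j; apply/zrowsZ/zrows_row.
Qed.

Lemma has_index_inj M L s s' : has_index M L s -> has_index M L s' -> s = s'.
Proof.
move=> h1 h2; apply/card_eq_II; apply: card_eq_trans h2; exact: card_esym.
Qed.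

(** With only one coset, each row of the known basis [B] shares the coset of 0 and so is an integral
    combination of the rows of [P]. *)
Lemma has_index1_zbasis M P B : zbasis M B -> (forall i, M (row i P)) ->
  has_index M (zrows P) 1 -> zbasis M P.
Proof.
move=> bM MP /eq_cardSP[c _]; set S := (X in (X `\ c)%classic).
rewrite II0 card_eq0 => /eqP; rewrite -subset0 => S1.
have eqc w : M w -> [set (w + u)%R | u in zrows P]%classic = c.
  move=> Mw; apply: contrapT => wc; have := S1 [set (w +
    u)%R | u in zrows P]%classic.
  by apply; split => //; exists w.
apply: (zbasis_change bM) => // i; rewrite -[row i B]subr0.
apply/zrows_coset; rewrite !eqc //; last exact: zbasis_row.
by case: bM => _ ->; exact: zrows0.
Qed.

Lemma zbasis_index M P : zbasis M P -> has_index M (zrows P) 1.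
Proof.
(* A basis is its own transverse basis, with [P_1] in the role of [C]. *)
move=> bM; apply: (@transverse_basis_index M P (row ord0 P) 1 (fun=> 0)).
split => //; last by rewrite scale1r big1 ?addr0 // => j _; rewrite scale0r.
rewrite (_ : replace _ _ _ = P) //; apply/row_matrixP => i.
by rewrite row_replace; case: eqP => // ->.
Qed.

End Index.

(** * Proper fractions of cones and their remainders *)

Section Fractions.
Variables (R : realType) (n : nat).
Local Notation V := 'rV[R]_n.+1.
Implicit Types (M : set V) (B P Q : 'M[R]_n.+1) (v C : V).
Implicit Types (f g : proper_frac n).

Lemma shift_cancel (U : zmodType) (x y w : U) : x = - y + (x + (y + w) - w).
Proof. by rewrite [x + (y + w)]addrA (addrK w) [- y + _]addrC (addrK y). Qed.

Lemma proper_frac_eq f g : den f = den g -> num f =1 num g -> f = g.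
Proof.
case: f g => a r ar [b r' br] /= er /ffunP ab; subst r' b.
by congr ProperFrac; exact: Prop_irrelevance.
Qed.

Lemma den_gt0 f : (0 < den f)%N.
Proof. exact: leq_ltn_trans (num_lt_den f ord0). Qed.

Lemma residueE m (x : int) : (0 < m)%N -> (residue m x)%:Z = (x %% m)%Z.
Proof. by move=> m0; rewrite /residue gez0_abs // modz_ge0 //; lia. Qed.

Lemma residue_unique m (x : int) k : (k < m)%N ->
  (exists q, k%:Z - x = q * m%:Z) -> k = residue m x.
Proof.
move=> km [q e]; apply/eqP; rewrite -eqz_nat residueE; last by lia.
have -> : x = (- q) * m + k%:Z by lia.
by rewrite modzMDl modz_small //; lia.
Qed.

Lemma residue_opp m (x : int) : (0 < m)%N ->
  x + (residue m (- x))%:Z = - (- x %/ m%:Z)%Z * m%:Z.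
Proof.
move=> m0; rewrite residueE //.
by have := divz_eq (- x) m; lia.
Qed.

Lemma oka_centerE P f :
  (den f)%:R *: oka_center P f = \sum_i (num f i)%:R *: row i P.
Proof.
rewrite /oka_center mulmx_sum_row scaler_sumr; apply: eq_bigr => i _.
rewrite !mxE scalerA mulrC divfK // pnatr_eq0 -lt0n; exact: den_gt0.
Qed.

Lemma cone_frac_transverse M P f : cone_frac M P f ->
  transverse_basis M P (oka_center P f) (den f)
    (fun j => - (num f (lift ord0 j))%:Z).
Proof.
move=> [_ _ f1 _ bM]; split => //; first exact: den_gt0.
rewrite oka_centerE big_ord_recl f1 scale1r -addrA -big_split /= big1 ?addr0 //.
by move=> j _; rewrite -scalerDl mulrNz subrr scale0r.
Qed.

(** Reducing the [- z j] modulo [s] gives the numerators; the quotients [q j] of this reduction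
    translate [C] to the Oka center by an integral combination of the [P_j], which preserves the
    basis. *)
Lemma transverse_basis_frac M P C s z : transverse_basis M P C s z ->
  (1 < s)%N -> exists2 f, cone_frac M P f & den f = s.
Proof.
move=> tb s1; have [bM s0 e] := tb.
case: s => // s in s1 s0 e tb *.
pose x (j : 'I_n.+1) := if unlift ord0 j is Some i then - z i else 1.
pose f := residue_frac s x.
have f0 : num f ord0 = 1%N.
  by rewrite /f /= ffunE /x unlift_none /residue modz_small //; lia.
pose q j := - (- z j %/ s.+1%:Z)%Z.
have qE j : z j + (num f (lift ord0 j))%:Z = q j * s.+1%:Z.
  by rewrite /f /= ffunE /x liftK; exact: residue_opp.
have sn0 : s.+1%:R != 0 :> R by rewrite pnatr_eq0.
have CE : oka_center P f = C + \sum_j (q j)%:~R *: row (lift ord0 j) P.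
  apply: (scalerI sn0); rewrite (oka_centerE P f) big_ord_recl f0 scale1r e.
  rewrite scalerDr -addrA; congr (_ + _); rewrite scaler_sumr -big_split /=.
  apply: eq_bigr => j _; rewrite scalerA -scalerDl; congr (_ *: _).
  by rewrite -[s.+1%:R]/(s.+1%:~R) -intrM mulrC -qE intrD.
have MP j := transverse_basis_row j tb.
have MC : M C by have := zbasis_row ord0 bM; rewrite row_replace eqxx.
have MC' : M (oka_center P f).
  rewrite CE; move: MC MP; case: bM => _ -> MC MP; apply: zrowsD => //.
  by apply: zrows_sum => j; apply: zrowsZ.
exists f => //; split => //; first exact: transverse_basis_index tb.
apply: (zbasis_change bM) => i; rewrite row_replace; first by case: eqP.
have rP j : zrows (replace P ord0 (oka_center P f)) (row (lift ord0 j) P).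
  by have := zrows_row (replace P ord0 (oka_center P f)) (lift ord0 j);
     rewrite replace_neq.
case: (unliftP ord0 i) => [j|] ->;
  first by rewrite [_ == _]eq_sym (negbTE (neq_lift _ _)).
rewrite eqxx; have -> : C = oka_center P f - \sum_j (q j)%:~R *: row (lift
  ord0 j) P.
  by rewrite CE addrK.
apply: zrowsB; last by apply: zrows_sum => j; exact: zrowsZ.
by have := zrows_row (replace P ord0 (oka_center P f)) ord0;
   rewrite row_replace eqxx.
Qed.

(** Uniqueness of the fraction, read off any transverse basis: the Oka center has coordinates
    [(z j + num f j) / s] there, and these are integers because it lies in the lattice. *)
Lemma cone_frac_residue M P C s z f : transverse_basis M P C s z ->
  cone_frac M P f ->
  den f = s /\ forall j, num f (lift ord0 j) = residue s (- z j).
Proof.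
move=> tb [hi _ f1 MC _]; have sE :=
  has_index_inj hi (transverse_basis_index tb).
split=> // j; apply: residue_unique; first by rewrite -sE num_lt_den.
have [bM s0 e] := tb.
have sn0 : s%:R != 0 :> R by rewrite pnatr_eq0 -lt0n.
pose a (j : 'I_n.+1) : R := if unlift ord0 j is Some i then
  (z i + (num f j)%:Z)%:~R / s%:R else 1.
have CE : oka_center P f = \sum_j a j *: row j (replace P ord0 C).
  rewrite (sum_replace0 P C a) /a unlift_none scale1r; apply: (scalerI sn0).
  rewrite -{1}sE oka_centerE big_ord_recl f1 scale1r e -addrA scalerDr.
  congr (_ + _); rewrite scaler_sumr -big_split /=; apply: eq_bigr => i _.
  by rewrite liftK scalerA -scalerDl mulrC divfK // intrD.
move: MC; rewrite CE => /(zbasis_coord bM)/(_ (lift ord0 j))[q].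
rewrite /a liftK => /(canRL (divfK sn0)).
rewrite -[s%:R]/(s%:~R) -intrM => /intr_inj qE; exists q.
by rewrite opprK addrC.
Qed.

(* Solving [s C = P_1 + sum_j b_j P_j] for [P_1] and completing by [- P_i]
   makes [b_i] the new index; the coefficients, negated modulo [b_i], are the
   numerators of [R_i]. *)
Lemma cone_frac_step M P f i : cone_frac M P f ->
  num f (lift ord0 i) != 0%N ->
  transverse_basis M (replace P (lift ord0 i) (oka_center P f))
    (- row (lift ord0 i) P) (num f (lift ord0 i))
    (fun j => if j == i then (den f)%:Z else - (num f (lift ord0 j))%:Z).
Proof.
move=> cf fi; have tb := cone_frac_transverse cf.
have [_ _ f1 MC bM] := cf; set C := oka_center P f in MC bM tb *.
set P' := replace P _ _.
have MP j := transverse_basis_row j tb.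
have lin : row ord0 P' = row ord0 P.
  by rewrite replace_neq // neq_lift.
have e : row ord0 P' = (num f (lift ord0 i))%:R *: - row (lift ord0 i) P +
    \sum_j (if j == i then (den f)%:Z else - (num f (lift ord0 j))%:Z)%:~R *:
      row (lift ord0 j) P'.
  have := oka_centerE P f; rewrite lin -/C big_ord_recl f1 scale1r (bigD1 i)
    //= => eC.
  rewrite [X in _ = _ + X](bigD1 i) //= row_replace !eqxx.
  rewrite -[_%:~R *: C]/(_%:R *: C) eC.
  rewrite [X in _ = _ + (_ + X)](_ : _ =
    - \sum_(j < n | j != i) (num f (lift ord0 j))%:R *: row (lift ord0 j) P).
    rewrite scalerN; exact: shift_cancel.
  rewrite -sumrN; apply: eq_bigr => j ji; rewrite (negbTE ji) replace_neq.
    by rewrite mulrNz scaleNr.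
  by rewrite (inj_eq lift_inj).
have PB (j : 'I_n) : j != i -> row (lift ord0 j) P' = row (lift ord0 j) P.
  by move=> ji; rewrite replace_neq // (inj_eq lift_inj).
split => //; last by rewrite lt0n.
(* The old basis has [C] at [ord0] and [P_i] at [lift ord0 i]; the new one has [- P_i] and [C] in
   these places, so they differ by a swap and a sign. *)
apply: (zbasis_change bM) => j.
  rewrite row_replace; case: eqP => _.
    move: (MP (lift ord0 i)); case: bM => _ -> /(zrowsZ (-1)).
    by rewrite mulrN1z scaleN1r.
  by rewrite /P' row_replace; case: eqP.
have B'E k := zrows_row (replace P' ord0 (- row (lift ord0 i) P)) k.
rewrite row_replace; case: (unliftP ord0 j) => [k|] ->; last first.
  rewrite eqxx; have := B'E (lift ord0 i).
  by rewrite replace_neq // /P' row_replace eqxx.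
rewrite [lift _ _ == _]eq_sym (negbTE (neq_lift _ _)); have [->|ki] :=
  eqVneq k i.
  have := B'E ord0; rewrite row_replace eqxx => /(zrowsZ (-1)).
  by rewrite mulrN1z scaleN1r opprK.
by have := B'E (lift ord0 k); rewrite replace_neq // PB.
Qed.

(** The numerators of [f'] are computed from the transverse basis of the refined cone, whose
    coefficients are exactly those that define [R_i]. *)
Lemma cone_frac_remainder M P f i f' : cone_frac M P f ->
  num f (lift ord0 i) != 0%N ->
  cone_frac M (replace P (lift ord0 i) (oka_center P f)) f' ->
  remainder_map i f = Some f'.
Proof.
move=> cf fi cf'; have [dE nE] := cone_frac_residue (cone_frac_step cf fi) cf'.
have [_ f'1 f'0 _ _] := cf'; have [_ _ f0 _ _] := cf.
rewrite /remainder_map; case: (num f (lift ord0 i)) fi dE nE => // m _ dE nE.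
congr Some; apply: proper_frac_eq; first by rewrite dE.
move=> j /=; rewrite ffunE; case: (unliftP ord0 j) => [k|] ->; last first.
  (* The leading numerator 1 survives reduction because the new denominator exceeds 1. *)
  by rewrite (negbTE (neq_lift _ _)) f0 f'0 /residue modz_small //; lia.
by rewrite (inj_eq lift_inj) nE; case: eqP => // _; rewrite opprK.
Qed.

Lemma remainder_coef_step i f f' g : remainder_map i f = Some f' ->
  remainder_coef f' g -> remainder_coef f g.
Proof.
by move=> e [w wg]; exists (i :: w); rewrite -wg /remainder_poly /= e.
Qed.

Lemma remainder_coef_self f : (1 < den f)%N -> remainder_coef f f.
Proof.
move=> f1; exists [::]; rewrite /remainder_poly /= /trivial_frac.
by rewrite (gtn_eqF f1).
Qed.

(** * Ages and bases along the Fujiki-Oka algorithm *)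

Lemma ageD v w : age (v + w) = age v + age w :> R.
Proof. by rewrite /age -big_split; apply: eq_bigr => i _; rewrite mxE. Qed.

Lemma ageZ (a : R) v : age (a *: v) = a * age v.
Proof. by rewrite /age mulr_sumr; apply: eq_bigr => i _; rewrite mxE. Qed.

Lemma age_sum m (a : 'I_m -> R) (F : 'I_m -> V) :
  age (\sum_i a i *: F i) = \sum_i a i * age (F i).
Proof.
elim/big_rec2: _ => [|i x v _ <-]; last by rewrite ageD ageZ.
by rewrite /age big1 // => i _; rewrite mxE.
Qed.

Lemma age_oka_center P f : (forall i, age (row i P) = 1) ->
  frac_age f = 1 -> age (oka_center P f) = 1.
Proof.
move=> P1.
have d0 (F : numFieldType) : (den f)%:R != 0 :> F.
  by rewrite pnatr_eq0 -lt0n den_gt0.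
(* [frac_age] is rational while [age] is real; the equation is carried across as an equality of
   natural numbers. *)
move=> /(canRL (divfK (d0 _))); rewrite mul1r => /eqP;
  rewrite eqr_nat => /eqP e.
apply: (mulfI (d0 R)); rewrite -ageZ oka_centerE age_sum mulr1 -e natr_sum.
by apply: eq_bigr => i _; rewrite P1 mulr1.
Qed.

(** The empty word makes [f] itself a coefficient, which gives the Oka center age 1. After a
    refinement at [i] any fraction of the new cone is [R_i] of the old one, so its coefficients
    occur in the old polynomial on words starting with [i], and the hypothesis on ages passes down
    the recursion. *)
Lemma fujiki_oka_age M P Q : fujiki_oka_cone M P Q ->
  (forall i, age (row i P) = 1) ->
  (forall f, cone_frac M P f -> forall g, remainder_coef f g -> frac_age g =
    1) ->
  forall i, age (row i Q) = 1.
Proof.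
elim=> {P Q} [P _ //|P f cf|P f i Q cf fi _ IH] P1 hf.
  have := hf _ cf _ (remainder_coef_self _); have [_ f1 _ _ _] := cf.
  move=> /(_ f1) fa j; rewrite row_replace; case: eqP => // _.
  exact: age_oka_center.
apply: IH => [j|f' cf' g gc].
  have := hf _ cf _ (remainder_coef_self _); have [_ f1 _ _ _] := cf.
  move=> /(_ f1) fa; rewrite row_replace; case: eqP => // _.
  exact: age_oka_center.
apply: (hf f cf); apply: remainder_coef_step gc.
exact: cone_frac_remainder cf'.
Qed.

Lemma fujiki_oka_zbasis M P Q : fujiki_oka_cone M P Q ->
  (exists B, zbasis M B) -> (forall i, M (row i P)) -> zbasis M Q.
Proof.
move=> foQ [B bM]; elim: foQ => {P Q} [P h1 MP|P f [] //|P f i Q cf _ _ IH MP].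
  exact: has_index1_zbasis bM MP h1.
by apply: IH => j; rewrite row_replace; case: eqP => // _; case: cf.
Qed.

(** Expand [P_1] in a basis that extends [P_2], ..., [P_n]: the coefficient on the added vector
    becomes the index once that vector has the right sign. *)
Lemma semi_unimodular_transverse M P : semi_unimodular M P ->
  exists C s z, transverse_basis M P C s z.
Proof.
move=> [fP Pp [B [bM rB]]].
have BP j : row (lift ord0 j) B = row (lift ord0 j) P.
  by apply/rowP => k; have /matrixP/(_ j k) := rB; rewrite !mxE.
have [MP _ _] := Pp ord0; have := bM; move=> [fB eM].
have /zrowsP[c] : zrows B (row ord0 P) by rewrite -eM.
rewrite big_ord_recl => cE.
(* Otherwise [P_1] would be a combination of the other rows of [P], against freeness. *)
have c0 : c ord0 != 0.
  apply/eqP => c0; move: cE; rewrite c0 scale0r add0r => cE.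
  pose a (j : 'I_n.+1) : R := (j == ord0)%:R.
  pose b (j : 'I_n.+1) : R :=
    if unlift ord0 j is Some i then (c (lift ord0 i))%:~R else 0.
  have /row_free_coord-/(_ fP ord0) :
      \sum_j a j *: row j P = \sum_j b j *: row j P.
    rewrite !big_ord_recl /a /b eqxx unlift_none scale0r scale1r add0r cE.
    rewrite [X in _ + X = _]big1 ?addr0 => [|j _]; last first.
      by rewrite [_ == _]eq_sym (negbTE (neq_lift _ _)) scale0r.
    by apply: eq_bigr => i _; rewrite liftK BP.
  by move/eqP; rewrite /a /b eqxx unlift_none oner_eq0.
pose C := (sgz (c ord0))%:~R *: row ord0 B.
have CM : M C by rewrite eM; apply/zrowsZ/zrows_row.
have BC : row ord0 B = (sgz (c ord0))%:~R *: C.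
  by rewrite scalerA -intrM mulz_sg c0 scale1r.
exists C, `|c ord0|%N, (fun j => c (lift ord0 j)); split;
  [|by rewrite absz_gt0|]; last first.
  rewrite cE; congr (_ + _); last by apply: eq_bigr => j _; rewrite BP.
  rewrite scalerA -[(`|_|%N)%:R]/((`|c ord0|%N)%:Z%:~R) -intrM;
    congr (_%:~R *: _).
  by rewrite {1}(intEsg (c ord0)) mulrC.
apply: (zbasis_change bM) => i; rewrite ?row_replace.
  by case: (unliftP ord0 i) => [j|] ->; [case: eqP => // _;
    case: (Pp (lift ord0 j))|rewrite eqxx].
case: (unliftP ord0 i) => [j|] ->.
  by rewrite BP; have := zrows_row (replace P ord0 C) (lift ord0 j);
     rewrite replace_neq.
rewrite BC; apply: zrowsZ.
by have := zrows_row (replace P ord0 C) ord0; rewrite row_replace eqxx.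
Qed.

End Fractions.

(** * Cones, faces, coverings and primitive ray generators *)

Section Cones.
Variables (R : realType) (n : nat).
Local Notation V := 'rV[R]_n.+1.
Implicit Types (M F tau : set V) (Sigma : set (set V)) (P Q : 'M[R]_n.+1).
Implicit Types (v x C : V) (f : proper_frac n).

Lemma coneP m (A : 'M[R]_(m, n.+1)) v : cone A v <->
  exists c : 'I_m -> R, (forall i, 0 <= c i) /\ v = \sum_i c i *: row i A.
Proof.
split=> [[c [c0 ->]]|[c [c0 ->]]].
  by exists (c 0); split=> //; rewrite mulmx_sum_row.
by exists (\row_i c i); split=> [i|]; rewrite ?mxE // sum_rows.
Qed.

Lemma cone_row m (A : 'M[R]_(m, n.+1)) i : cone A (row i A).
Proof.
exists (delta_mx 0 i); split; last by rewrite rowE.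
by move=> j; rewrite mxE ler0n.
Qed.

Lemma coneD m (A : 'M[R]_(m, n.+1)) v x : cone A v -> cone A x -> cone A (v +
  x).
Proof.
move=> [c [c0 ->]] [d [d0 ->]]; exists (c + d); split; last by rewrite mulmxDl.
by move=> i; rewrite mxE addr_ge0.
Qed.

Lemma coneZ m (A : 'M[R]_(m, n.+1)) (a : R) v : 0 <= a -> cone A v ->
  cone A (a *: v).
Proof.
move=> a0 [c [c0 ->]]; exists (a *: c); split; last by rewrite scalemxAl.
by move=> i; rewrite mxE mulr_ge0.
Qed.

Lemma cone_sub m m' (A : 'M[R]_(m, n.+1)) (B : 'M[R]_(m', n.+1)) :
  (forall i, cone B (row i A)) -> (cone A `<=` cone B)%classic.
Proof.
move=> AB v /coneP[c [c0 ->]]; elim/big_ind: _ => [||i _].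
- by exists 0; split; [move=> i; rewrite mxE | rewrite mul0mx].
- by move=> *; exact: coneD.
- exact: coneZ.
Qed.

Lemma oka_center_cone P f : cone P (oka_center P f).
Proof. by exists (frac_vec R f); split => // i; rewrite mxE divr_ge0. Qed.

Lemma fujiki_oka_cone_sub M P Q : fujiki_oka_cone M P Q ->
  (cone Q `<=` cone P)%classic.
Proof.
have rep P' i f : (cone (replace P' i (oka_center P' f)) `<=` cone P')%classic.
  apply: cone_sub => j; rewrite row_replace.
  case: eqP => _; [exact: oka_center_cone | exact: cone_row].
by elim=> {P Q} [P _ x //|P f _ x /rep //|P f i Q _ _ _ IH x /IH /rep].
Qed.

(* Subtracting the largest multiple of the Oka center that keeps all
   coefficients nonnegative kills the coefficient of some generator. *)
Lemma oka_star_cover P f x : num f ord0 = 1%N -> cone P x ->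
  exists i, num f i != 0%N /\ cone (replace P i (oka_center P f)) x.
Proof.
move=> f0 /coneP[c [c0 xE]].
have p0 : (num f ord0 != 0)%N by rewrite f0.
case: (arg_minP (P := fun i => num f i != 0%N)
  (fun i => c i / (num f i)%:R) p0) => i fi imin; exists i; split=> //.
set t := c i / (num f i)%:R in imin *.
have t0 : 0 <= t by rewrite divr_ge0.
apply/coneP; exists (fun j => if j == i then t * (den f)%:R
  else c j - t * (num f j)%:R); split=> [j|].
  case: eqP => _; first by rewrite mulr_ge0.
  rewrite subr_ge0; have [->|fj] := eqVneq (num f j) 0%N;
    first by rewrite mulr0.
  by rewrite -ler_pdivlMr ?ltr0n ?lt0n //; exact: imin.
rewrite sum_replace eqxx -scalerA oka_centerE scaler_sumr xE.
rewrite (bigD1 i) //= [X in _ = X + _](bigD1 i) //= scalerA divfK ?pnatr_eq0 //.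
rewrite -addrA; congr (_ + _); rewrite -big_split; apply: eq_bigr => j ji /=.
by rewrite (negbTE ji) scalerA -scalerDl subrKC.
Qed.

(** Strong induction on the index: the star subdivision at the Oka center puts [x] in a smooth cone
    or in one of index [num f (lift ord0 j) < s]. A transverse basis is what a refinement step
    passes on, and it supplies the next fraction. *)
Lemma fujiki_oka_cover M P C s z x : transverse_basis M P C s z -> cone P x ->
  exists2 Q, fujiki_oka_cone M P Q & cone Q x.
Proof.
elim/ltn_ind: s P C z => s IH P C z tb Px.
have [s1|] := ltnP 1 s; last first.
  move=> s1; exists P => //; apply: FO_unchanged.
  have [_ s0 _] := tb; have e : s = 1%N by lia.
  by rewrite -e; exact: transverse_basis_index tb.
have [f cf fs] := transverse_basis_frac tb s1.
have [_ _ f0 _ _] := cf; have [i [fi Qx]] := oka_star_cover f0 Px.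
case: (unliftP ord0 i) fi Qx => [j|] -> fi Qx; last first.
  by exists (replace P ord0 (oka_center P f)) => //; exact: FO_smooth.
have lts : (num f (lift ord0 j) < s)%N by rewrite -fs num_lt_den.
have [Q foQ Q'x] := IH _ lts _ _ _ (cone_frac_step cf fi) Qx.
by exists Q => //; exact: FO_step foQ.
Qed.

Lemma is_face_refl tau : is_face tau tau.
Proof.
exists 0; split=> [x _|]; first by rewrite mulmx0 mxE.
by apply/seteqP; split=> [x tx|x []//]; split=> //; rewrite mulmx0 mxE.
Qed.

Lemma is_face_sub F tau : is_face F tau -> (F `<=` tau)%classic.
Proof. by move=> [u [_ ->]] x []. Qed.

(** The functional [u] cutting out the face is nonnegative on every row, so when it vanishes on a
    nonnegative combination it vanishes on each term; [S] collects the rows it kills. *)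
Lemma face_generators Q F : is_face F (cone Q) ->
  exists S : {set 'I_n.+1}, (forall i, i \in S <-> F (row i Q)) /\
    forall v, F v -> exists c : 'I_n.+1 -> R,
      [/\ forall i, 0 <= c i, forall i, i \notin S -> c i = 0 &
          v = \sum_i c i *: row i Q].
Proof.
move=> [u [u0 ->]]; exists [set i | (row i Q *m u) 0 0 == 0]; split.
  move=> i; rewrite inE; split=> [/eqP ui|[_ ->]//]; split=> //;
    exact: cone_row.
move=> _ [/coneP[c [c0 ->]] vu]; exists c; split=> // i; rewrite inE => ui.
move: vu; rewrite mulmx_suml summxE => /eqP; rewrite psumr_eq0; last first.
  move=> j _; rewrite -scalemxAl mxE mulr_ge0 // u0 //; exact: cone_row.
move=> /allP/(_ i (mem_index_enum _)); rewrite -scalemxAl mxE mulf_eq0.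
by rewrite (negbTE ui) orbF => /eqP.
Qed.

Lemma face_smooth M Q F : zbasis M Q -> is_face F (cone Q) -> smooth_cone M F.
Proof.
move=> bM fF; have [S [SF SP]] := face_generators fF.
exists Q; split=> //; exists #|S|, (fun k : 'I_#|S| => enum_val k).
split; first exact: enum_val_inj.
have rs (k : 'I_#|S|) : row k (rowsub (fun k : 'I_#|S| => enum_val k) Q) =
  row (enum_val k) Q.
  by apply/rowP => j; rewrite !mxE.
apply/seteqP; split=> v.
  move=> /SP[c [c0 cS ->]]; apply/coneP; exists (fun k => c (enum_val k)).
  split=> //; rewrite (bigID (mem S)) /= [X in _ + X]big1 ?addr0; last first.
    by move=> i /cS ->; rewrite scale0r.
  by rewrite big_enum_val; apply: eq_bigr => k _; rewrite rs.
move: fF => [u [u0 FE]] /coneP[c [c0 vE]].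
have Fk (k : 'I_#|S|) : F (row (enum_val k) Q) by apply/SF; exact: enum_valP.
rewrite FE; split.
  rewrite vE; elim/big_ind: _ => [||k _].
  - by exists 0; split; [move=> i; rewrite mxE | rewrite mul0mx].
  - by move=> *; exact: coneD.
  - by rewrite rs; apply: coneZ => //; exact: cone_row.
rewrite vE mulmx_suml summxE big1 // => k _; rewrite -scalemxAl mxE rs.
by have := Fk k; rewrite FE => -[_ ->]; rewrite mulr0.
Qed.

(** The supporting functional [u] sums the coordinates other than the [i]-th with respect to the
    rows of [P]. *)
Lemma is_face_ray P i : row_free P -> is_face (cone (row i P)) (cone P).
Proof.
move=> fP; pose u : 'cV[R]_n.+1 := invmx P *m (\col_j (j != i)%:R).
have uP : P \in unitmx by rewrite -row_free_unit.
have ucE (c : 'rV[R]_n.+1) : (c *m P *m u) 0 0 = \sum_(j | j != i) c 0 j.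
  rewrite /u mulmxA mulmxK // mxE [RHS]big_mkcond; apply: eq_bigr => j _.
  by rewrite mxE; case: eqP; rewrite ?mulr1 ?mulr0.
exists u; split=> [_ [c [c0 ->]]|].
  by rewrite ucE sumr_ge0.
apply/seteqP; split=> v.
  move=> /coneP[c [c0 ->]]; rewrite big_ord1.
  have -> : row 0 (row i P) = delta_mx 0 i *m P.
    by rewrite -rowE; apply/rowP => j; rewrite !mxE.
  split; first by apply: coneZ => //; rewrite -rowE; exact: cone_row.
  rewrite scalemxAl ucE big1 // => j ji.
  by rewrite !mxE (negbTE ji) andbF mulr0.
move=> [[c [c0 ->]]]; rewrite ucE => /eqP; rewrite psumr_eq0 // => /allP cj.
apply/coneP; exists (fun=> c 0 i); split => //; rewrite big_ord1.
rewrite mulmx_sum_row (bigD1 i) //= big1 ?addr0 => [|j ji].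
  by congr (_ *: _); apply/rowP => j; rewrite !mxE.
have := cj j (mem_index_enum _); rewrite ji /= => /eqP ->.
by rewrite scale0r.
Qed.

(** If [tau] contains [cone Q], then [cone Q] is a face of [tau]; the functional cutting it out
    vanishes on a basis of the space, hence is 0, and the face is all of [tau]. *)
Lemma fan_simplicial_maximal M Sigma Q : is_fan M Sigma -> row_free Q ->
  Sigma (cone Q) -> maximal_cone Sigma (cone Q).
Proof.
move=> fan fQ SQ; split=> // tau St Qt.
have [_ [u [_]]] := fan_meet fan SQ St; rewrite setIidl // => QE.
have Qu : Q *m u = 0.
  apply/row_matrixP => i; rewrite row_mul row0.
  have := cone_row Q i; rewrite QE => -[_ e]; apply/matrixP => j k.
  by rewrite !ord1 e mxE.
have u0 : u = 0.
  have uQ : Q \in unitmx by rewrite -row_free_unit.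
  by rewrite -[u](mulKmx uQ) Qu mulmx0.
rewrite QE u0; apply/seteqP; split=> [x tx|x []//].
by split=> //; rewrite mulmx0 mxE.
Qed.

Lemma orthantE : @orthant R n = cone 1%:M.
Proof.
apply/seteqP; split=> v; first by move=> v0; exists v; rewrite mulmx1.
by move=> [c [c0 ->]]; rewrite mulmx1.
Qed.

(* Since [age q = 1], the age of [v] is [1 / t], hence a positive integer [p];
   then [v = p q], and primitivity forces [p = 1]. *)
Lemma primitive_age1 M v q (t : R) :
  (forall w, M w -> exists a : int, age w = a%:~R) ->
  Defs.primitive M v -> M q -> age q = 1 -> 0 <= t -> q = t *: v -> age v = 1.
Proof.
move=> intM [Mv v0 vprim] Mq q1 t0 qE; have [a aE] := intM v Mv.
move: q1; rewrite qE ageZ aE => ta.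
have t_gt0 : 0 < t.
  by rewrite lt_neqAle t0 andbT; apply: contra_eqN ta => /eqP <-;
     rewrite mul0r eq_sym oner_eq0.
have a_gt0 : 0 < a.
  by rewrite -(ltr0z R) -(pmulr_rgt0 _ t_gt0) ta ltr01.
case: a a_gt0 aE ta => // m _ aE ta.
have vq : v = q *+ m.
  by rewrite -scaler_nat qE scalerA mulrC -[m%:R]/(m%:~R) ta scale1r.
by rewrite (vprim q m Mq vq).
Qed.

(** Some row of [Q] lies on the ray of [v], since otherwise [v] would be 0; that row is a lattice
    vector of age 1 on the ray of a primitive vector. *)
Lemma face_ray_age1 M Q v :
  (forall w, M w -> exists a : int, age w = a%:~R) ->
  (forall i, M (row i Q)) -> (forall i, age (row i Q) = 1) ->
  Defs.primitive M v -> is_face (cone v) (cone Q) -> age v = 1.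
Proof.
move=> intM MQ Q1 pv fv; have [S [SF SP]] := face_generators fv.
have Fv : cone v v.
  by have := cone_row v 0; rewrite (_ : row 0 v = v) //; apply/rowP => j;
    rewrite mxE.
have [c [c0 cS vE]] := SP v Fv.
have [S0|[i iS]] := set_0Vmem S.
  have [_ /eqP v0 _] := pv; case: v0; rewrite vE big1 // => i _.
  by rewrite cS ?scale0r // S0 inE.
have /SF/coneP[d [d0]] := iS; rewrite big_ord1 => qE.
apply: (primitive_age1 intM pv (MQ i) (Q1 i) (d0 0)).
by rewrite qE; congr (_ *: _); apply/rowP => j; rewrite mxE.
Qed.

End Cones.

(** * The lattices of the subgroups and integrality of ages *)

Section Lattices.
Variables (R : realType) (n : nat).
Local Notation V := 'rV[R]_n.+1.

Lemma cexp_turnD (s t : R) : cexp_turn (s + t) = cexp_turn s * cexp_turn t.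
Proof.
apply/eqP; rewrite eq_complex /= mulrDr cosD sinD eqxx /=.
by rewrite [sin _ * _ + _]addrC.
Qed.

Lemma cexp_turn_sum (I : finType) (F : I -> R) :
  cexp_turn (\sum_i F i) = \prod_i cexp_turn (F i).
Proof.
apply: (big_morph _ cexp_turnD).
by rewrite /cexp_turn mulr0 cos0 sin0.
Qed.

Lemma cexp_turn_eq1 (t : R) : 0 <= t -> cexp_turn t = 1 ->
  exists a : int, t = a%:~R.
Proof.
move=> t0 /eqP; rewrite eq_complex /= => /andP[/eqP ct _].
(* As [t] is nonnegative, [truncn] is its floor. The fractional part [e] satisfies
   [cos (2 pi e) = 1], so [sin (pi e) = 0] by the double angle formula, while the sine is positive
   on the open interval from 0 to [pi]. *)
exists (Num.truncn t)%:Z; set k := Num.truncn t.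
pose e := t - k%:R; have /andP[kt tk] := truncn_itv t0.
have e0 : 0 <= e by rewrite subr_ge0.
have e1 : e < 1 by rewrite ltrBlDl natr1.
have ce : cos ((pi * e) *+ 2) = 1 :> R.
  rewrite -ct -(periodicn (@cosD2pi R) k) /e; congr cos.
  by rewrite -mulr_natr -[pi *+ 2 *+ k]mulr_natr -[pi *+ 2]mulr_natr; ring.
have : sin (pi * e) ^+ 2 = 0 :> R.
  have := cos2Dsin2 (pi * e); move: ce; rewrite cos_mulr2n.
  by move: (cos _ ^+ 2) (sin _ ^+ 2) => x y; lra.
move/eqP; rewrite expf_eq0 /= => /eqP se.
move: e0; rewrite le_eqVlt => /predU1P[/eqP|e_gt0].
  by rewrite eq_sym subr_eq0 => /eqP.
have : 0 < sin (pi * e) :> R.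
  by apply: sin_gt0_pi; rewrite mulr_gt0 ?pi_gt0 //= gtr_pMr ?pi_gt0.
by rewrite se ltxx.
Qed.

Lemma zspan_sub (S T : set V) : (S `<=` T)%classic ->
  (zspan S `<=` zspan T)%classic.
Proof.
by move=> ST v [m [A [SA Av]]]; exists m, A; split=> // i; apply: ST.
Qed.

Variables (gT : finGroupType) (G : {group gT}).
Variable rG : mx_representation R[i] G n.+1.

Lemma group_lattice_sub (H K : {group gT}) : H \subset K ->
  (group_lattice rG H `<=` group_lattice rG K)%classic.
Proof.
move=> /fintype.subsetP HK v [z [u [Su ->]]]; exists z, u; split=> //.
by apply: zspan_sub Su => w [f [h [hH e we]]]; exists f, h; split=> //;
  exact: HK.
Qed.

Lemma group_lattice_unit (H : {group gT}) i : group_lattice rG H (row i 1%:M).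
Proof.
exists (delta_mx 0 i), 0; split; last by rewrite addr0 map_delta_mx row1.
(* The group part is 0, taken as the combination of an empty family. *)
by exists 0%N, 0; split=> [[]//|]; exists 0; rewrite mulmx0.
Qed.

(** The determinant of a diagonal matrix with exponent vector [w] is [cexp_turn (age w)], so
    determinant 1 makes the age of each group generator an integer; integral vectors have integral
    age, and age is additive. *)
Lemma group_lattice_age (H : {group gT}) v :
  (forall h, h \in H -> \det (rG h) = 1) -> group_lattice rG H v ->
  exists a : int, age v = a%:~R.
Proof.
move=> SL [z [u [[m [A [SA [y ->]]]] ->]]].
have /(_ _)/cid-/all_sig[a aE] i : exists a : int, age (row i A) = a%:~R.
  have [f [h [hH rh ->]]] := SA i.
  apply: cexp_turn_eq1; first by apply: sumr_ge0 => j _; rewrite mxE divr_ge0.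
  have := SL h hH; rewrite rh det_diag => <-; rewrite /age cexp_turn_sum.
  by apply: eq_bigr => j _; rewrite !mxE.
exists (\sum_j z 0 j + \sum_i y 0 i * a i).
rewrite ageD intrD !(raddf_sum intr) mulmx_sum_row age_sum.
congr (_ + _); first by apply: eq_bigr => j _; rewrite mxE.
by apply: eq_bigr => j _; rewrite mxE aE /= intrM.
Qed.

End Lattices.

(** * The invariant carried from one stage to the next *)

Section Stages.
Variables (R : realType) (n : nat).
Local Notation V := 'rV[R]_n.+1.
Implicit Types (M : set V) (Sigma : set (set V)).

(** The rows of [Q] are only required to be lattice vectors, not primitive ones, so that the
    property survives an enlargement of the lattice. *)
Definition age_one_cover M Sigma : Prop :=
  [/\ forall tau, maximal_cone Sigma tau -> exists Q : 'M[R]_n.+1,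
        [/\ tau = cone Q, forall i, M (row i Q) & forall i, age (row i Q) = 1],
      forall x, orthant x -> exists2 tau, maximal_cone Sigma tau & tau x
    & forall tau, Sigma tau -> (tau `<=` @orthant R n)%classic].

Lemma orthant_faces_cover M : (forall i : 'I_n.+1, M (row i 1%:M)) ->
  age_one_cover M [set F | is_face F (@orthant R n)].
Proof.
move=> M1; have sub F : is_face F (@orthant R n) ->
  (F `<=` @orthant R n)%classic.
  exact: is_face_sub.
have max : maximal_cone [set F | is_face F (@orthant R n)] (@orthant R n).
  split; first exact: is_face_refl.
  by move=> F fF oF; apply/seteqP; split=> //; exact: sub.
split=> [tau [ft tmax]|x ox|//]; last by exists (@orthant R n).
exists 1%:M; split=> // [|i].
  by rewrite -orthantE; symmetry; apply: tmax; [exact: is_face_refl|exact: sub].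
rewrite /age (bigD1 i) //= !mxE eqxx big1 ?addr0 // => j ji.
by rewrite !mxE eq_sym (negbTE ji).
Qed.

Lemma age_one_cover_sub M M' Sigma : (M `<=` M')%classic ->
  age_one_cover M Sigma -> age_one_cover M' Sigma.
Proof.
move=> MM' [maxS covS subS]; split=> // tau /maxS[Q [tQ MQ Q1]].
by exists Q; split=> // i; exact: MM'.
Qed.

Lemma fujiki_oka_fan_cover M (P : set V -> 'M[R]_n.+1) Sigma :
  (forall w, M w -> exists a : int, age w = a%:~R) ->
  age_one_cover M Sigma ->
  (forall tau, maximal_cone Sigma tau ->
     tau = cone (P tau) /\ semi_unimodular M (P tau)) ->
  (forall f, fan_frac M P Sigma f ->
     forall g, remainder_coef f g -> frac_age g = 1) ->
  is_fan M (fujiki_oka_fan M P Sigma) ->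
  age_one_cover M (fujiki_oka_fan M P Sigma) /\
  forall F, fujiki_oka_fan M P Sigma F -> exists Q : 'M[R]_n.+1,
    [/\ zbasis M Q, is_face F (cone Q) & forall i, age (row i Q) = 1].
Proof.
move=> intM [maxS covS subS] genS fracS fan.
have key tau Q : maximal_cone Sigma tau -> fujiki_oka_cone M (P tau) Q ->
    [/\ zbasis M Q, forall i, age (row i Q) = 1 & (cone Q `<=` tau)%classic].
  move=> mt foQ; have [tP su] := genS _ mt; have [fP pP [B [bM _]]] := su.
  have [Q0 [tQ0 MQ0 Q01]] := maxS _ mt.
  split.
  - by apply: (fujiki_oka_zbasis foQ); [exists B | move=> i; case: (pP i)].
  - apply: (fujiki_oka_age foQ) => [i|f cf].
      (* The chosen generators are primitive in the present lattice and span rays of the same cone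
         as the age 1 vectors [Q0], hence have age 1 themselves. *)
      apply: (face_ray_age1 intM _ Q01 (pP i)) => //.
      by rewrite -tQ0 [X in is_face _ X]tP; exact: is_face_ray.
    (* A cone with a fraction has index above 1, so its generators are not a basis and the
       hypothesis on ages applies. *)
    apply: fracS; exists tau; split=> // /zbasis_index h1.
    by have [hi] := cf; rewrite (has_index_inj hi h1).
  - by rewrite [X in (_ `<=` X)%classic]tP; exact: fujiki_oka_cone_sub foQ.
have smooth F : fujiki_oka_fan M P Sigma F -> exists Q : 'M[R]_n.+1,
    [/\ zbasis M Q, is_face F (cone Q) & forall i, age (row i Q) = 1].
  by move=> [tau [Q [mt foQ fF]]]; have [bM Q1 _] := key _ _ mt foQ; exists Q.
split=> //; split.
- move=> F [[tau [Q [mt foQ fF]]] Fmax]; have [bM Q1 _] := key _ _ mt foQ.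
  exists Q; split=> // [|i]; last exact: zbasis_row.
  (* [F] is a face of [cone Q], which belongs to the same fan, so maximality identifies the two. *)
  symmetry; apply: Fmax; last exact: is_face_sub.
  by exists tau, Q; split=> //; exact: is_face_refl.
- move=> x /covS[tau mt tx]; have [tP su] := genS _ mt.
  have [C [s [z tb]]] := semi_unimodular_transverse su.
  have [Q foQ Qx] : exists2 Q, fujiki_oka_cone M (P tau) Q & cone Q x.
    by apply: (fujiki_oka_cover tb); rewrite -tP.
  have [[fQ _] _ _] := key _ _ mt foQ.
  exists (cone Q) => //; apply: (fan_simplicial_maximal fan fQ).
  by exists tau, Q; split=> //; exact: is_face_refl.
- move=> F [tau [Q [mt foQ fF]]] x /(is_face_sub fF) Qx.
  have [_ _ Qt] := key _ _ mt foQ; case: mt => St _.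
  exact: subS St _ (Qt _ Qx).
Qed.

End Stages.

Theorem theorem4p3 (R : realType) (n : nat) (gT : finGroupType)
    (G : {group gT}) (rG : mx_representation R[i] G n.+1)
    (rG_faithful : mx_faithful rG)
    (rG_diag : forall g, g \in G -> is_diag_mx (rG g))
    (rG_SL : forall g, g \in G -> \det (rG g) = 1)
    (abelG : abelian G)
    (k : nat) (H : nat -> {group gT})
    (Sigma : nat -> set (set 'rV[R]_n.+1))
    (P : nat -> set 'rV[R]_n.+1 -> 'M[R]_n.+1)
    (hseq : iterated_fujiki_oka rG k H Sigma P)
    (hage : forall i, (1 <= i <= k)%N ->
       forall f, fan_frac (group_lattice rG (H i)) (P i) (Sigma i.-1) f ->
       forall g, remainder_coef f g -> frac_age g = 1) :
  crepant_resolution (group_lattice rG G) (Sigma k).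
Proof.
have [k0 _ Hk dirH S0 gen sub fan] := hseq.
have HS i : (0 < i < k)%N -> H i \subset H i.+1.
  by move=> /dirH[K /dprodW <-]; exact: mulG_subl.
(* Induction on the distance [d] to the last stage, where the subgroup is [G]. *)
have HG i d : (0 < i)%N -> (i + d = k)%N -> H i \subset G.
  elim: d i => [|d IH] i i0 id; first by rewrite -Hk -id addn0.
  by apply: (fintype.subset_trans (HS i _)); [lia | apply: IH; lia].
have intH i w : (0 < i <= k)%N -> group_lattice rG (H i) w ->
    exists a : int, age w = a%:~R.
  move=> ik; apply: group_lattice_age => h hH; apply: rG_SL.
  by apply: (fintype.subsetP (HG i (k - i)%N _ _)) hH; lia.
have step i : (i < k)%N ->
    age_one_cover (group_lattice rG (H i.+1)) (Sigma i) ->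
    age_one_cover (group_lattice rG (H i.+1)) (Sigma i.+1) /\
    forall F, Sigma i.+1 F -> exists Q : 'M[R]_n.+1,
      [/\ zbasis (group_lattice rG (H i.+1)) Q, is_face F (cone Q) &
          forall j, age (row j Q) = 1].
  move=> ik ac; have ik' : (1 <= i.+1 <= k)%N by lia.
  have := fan _ ik'; rewrite (sub _ ik') => fan_i.
  apply: fujiki_oka_fan_cover ac _ _ fan_i;
    [|exact: (gen i.+1)|exact: (hage i.+1)].
  by move=> w; exact: intH.
(* [Sigma i] is paired with the lattice of the next stage, in which it will be subdivided; the
   invariant obtained there then moves on to the following, larger lattice. *)
have cover i : (i < k)%N -> age_one_cover (group_lattice rG (H i.+1)) (Sigma i).
  elim: i => [|i IH] ik.
    by rewrite S0; apply: orthant_faces_cover => i; exact: group_lattice_unit.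
  have /step[|ac _] := IH (ltnW ik); first exact: ltnW.
  by apply: age_one_cover_sub ac; apply/group_lattice_sub/HS; lia.
have kk : (1 <= k <= k)%N by lia.
have k1 : (k.-1 < k)%N by lia.
have [] := step _ k1 (cover _ k1);
  rewrite (prednK k0) Hk => -[_ ocov ofull] smooth.
split.
  split; first by have := fan k kk; rewrite Hk.
    by move=> F /smooth[Q [bM fF _]]; exact: face_smooth bM fF.
  apply/seteqP; split=> [x [tau St tx]|x /ocov[tau [St _] tx]].
    exact: ofull St _ tx.
  by exists tau.
(* Each ray of the last fan is a face of a cone on a basis of vectors of age 1, so its primitive
   generator has age 1 and discrepancy 0. *)
move=> v [pv /smooth[Q [bM fF Q1]]]; apply/eqP; rewrite subr_eq0; apply/eqP.
apply: (face_ray_age1 _ _ Q1 pv fF) => [w|i]; last exact: zbasis_row.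
by apply: group_lattice_age => h; exact: rG_SL.
Qed.
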